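(* Let $c:\mathbb{N}\to(0,\infty)$ be an unbounded function with $c(n)=o(n)$, and let $p(n)=\frac{c(n)}{n}$. Then there is a function $f(n)=o(n)$ such that $$\lim_{n\to\infty}\mathbb{P}\big(\mathrm{gon}(G(n,p(n)))\ge n-f(n)\big)=1.$$
   Context: $G(n,p)$ denotes the Erdős–Rényi random graph: a simple graph on $n$ labeled vertices in which each possible edge is present independently with probability $p$. For a finite graph $G$, a divisor is a formal integer combination $D=\sum_{v\in V(G)} D(v)\,v$ of vertices; its degree is $\sum_v D(v)$, and it is effective if $D(v)\ge 0$ for all $v$. Firing a vertex $v$ means moving one chip from $v$ along each edge incident to $v$; two divisors are equivalent if one can be obtained from the other by a sequence of firings and reverse firings (equivalently, their difference lies in the image of the graph Laplacian). A divisor $D$ has positive rank if for every vertex $v$, $D-v$ is equivalent to an effective divisor. The gonality $\mathrm{gon}(G)$ is the minimum degree of a divisor of positive rank.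
   Formalization: ''Unbounded'' is taken to mean c(n) tends to infinity; with c merely not bounded above the claim fails, e.g. c(n)=1 for even n and sqrt(n) for odd n, where for even n linearly many isolated edges force gon ≤ n − Ω(n). *)

(* Defs.v *)
From HB Require Import structures.
From Stdlib Require Import Relation_Operators.
From mathcomp Require Import all_boot all_order all_algebra.
From mathcomp Require Import all_classical all_reals all_analysis.

Set Implicit Arguments.
Unset Strict Implicit.
Unset Printing Implicit Defensive.

Import Order.TTheory GRing.Theory Num.Theory.
Import numFieldNormedType.Exports.

Local Open Scope ring_scope.

(** A simple graph on the vertex set ['I_n] is a set of unordered pairs of
    distinct vertices. *)
Definition vpair (n : nat) := {e : {set 'I_n} | #|e| == 2}.

Definition graph (n : nat) := {set vpair n}.

(** Irreflexive, since [[set u; u]] has cardinality 1. *)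
Definition adj (n : nat) (G : graph n) (u v : 'I_n) : bool :=
  [set u; v] \in [set val e | e in G].

Definition vdeg (n : nat) (G : graph n) (v : 'I_n) : nat :=
  #|[set w | adj G v w]|.

Definition divisor (n : nat) := {ffun 'I_n -> int}.

Definition deg (n : nat) (D : divisor n) : int := \sum_v D v.

Definition effective (n : nat) (D : divisor n) : Prop := forall v, 0 <= D v.

Definition vertex (n : nat) (v : 'I_n) : divisor n := [ffun w => (w == v)%:R].

Definition fire (n : nat) (G : graph n) (v : 'I_n) (D : divisor n) : divisor n :=
  [ffun w => if w == v then D v - (vdeg G v)%:Z else D w + (adj G v w)%:R].

(** Reflexive-symmetric-transitive closure of firing: the symmetric closure
    accounts for reverse firings. *)
Definition equivalent (n : nat) (G : graph n) : divisor n -> divisor n -> Prop :=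
  clos_refl_sym_trans (divisor n) (fun D D' => exists v, D' = fire G v D).

Definition positive_rank (n : nat) (G : graph n) (D : divisor n) : Prop :=
  forall v, exists2 E, equivalent G (D - vertex v) E & effective E.

Lemma adj_sym (n : nat) (G : graph n) (u v : 'I_n) : adj G u v = adj G v u.
Proof. by rewrite /adj finset.setUC. Qed.

Lemma adj_irrefl (n : nat) (G : graph n) (v : 'I_n) : adj G v v = false.
Proof.
apply/negbTE/negP => /imsetP[e _ E]; have := valP e.
by rewrite /= -E finset.setUid cards1.
Qed.

(** [L *m s] for the graph Laplacian [L] and an integer vector [s]. *)
Definition laplacian (n : nat) (G : graph n) (s : 'I_n -> int) : divisor n :=
  [ffun w => (vdeg G w)%:Z * s w - \sum_(v | adj G v w) s v].

Lemma fireE (n : nat) (G : graph n) (v : 'I_n) (D : divisor n) :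
  fire G v D = D - laplacian G (fun w => (w == v)%:R).
Proof.
apply/ffunP => w; rewrite !ffunE.
have -> : \sum_(u | adj G u w) (u == v)%:R = (adj G v w)%:R :> int.
  case: (boolP (adj G v w)) => avw.
    by rewrite (bigD1 v) //= eqxx big1 ?addr0 // => i /andP[_ /negbTE ->].
  rewrite big1 // => i aiw; case: eqVneq => // E.
  by move: avw; rewrite -E aiw.
case: eqVneq => [->|_]; last by rewrite mulr0 sub0r opprK.
by rewrite adj_irrefl mulr1 subr0.
Qed.

Lemma laplacianD (n : nat) (G : graph n) (s t : 'I_n -> int) :
  laplacian G (fun v => s v + t v) = laplacian G s + laplacian G t.
Proof.
by apply/ffunP => w; rewrite !ffunE big_split /= mulrDr opprD addrACA.
Qed.

Lemma laplacianN (n : nat) (G : graph n) (s : 'I_n -> int) :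
  laplacian G (fun v => - s v) = - laplacian G s.
Proof. by apply/ffunP => w; rewrite !ffunE sumrN mulrN opprD. Qed.

Lemma laplacian0 (n : nat) (G : graph n) : laplacian G (fun=> 0) = 0.
Proof. by apply/ffunP => w; rewrite !ffunE big1 // mulr0 subr0. Qed.

Lemma eq_laplacian (n : nat) (G : graph n) (s t : 'I_n -> int) :
  s =1 t -> laplacian G s = laplacian G t.
Proof.
by move=> st; apply/ffunP => w; rewrite !ffunE st; congr (_ - _); apply: eq_bigr.
Qed.

Lemma equivalent_subN (n : nat) (G : graph n) (D : divisor n) (v : 'I_n) :
  equivalent G D (D - laplacian G (fun w => (w == v)%:R)) /\
  equivalent G D (D + laplacian G (fun w => (w == v)%:R)).
Proof.
split; first by apply: rst_step; exists v; rewrite fireE.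
by apply: rst_sym; apply: rst_step; exists v; rewrite fireE addrK.
Qed.

Lemma equivalent_fire_mul (n : nat) (G : graph n) (v : 'I_n) (a : int)
    (D : divisor n) :
  equivalent G D (D - laplacian G (fun w => (w == v)%:R) *~ a).
Proof.
set L := laplacian _ _; elim/int_ind: a => [|k IH|k IH].
- by rewrite mulr0z subr0; apply: rst_refl.
- apply: rst_trans IH _; have [+ _] := equivalent_subN G (D - L *~ k%:Z) v.
  by rewrite -/L -addrA -opprD [k.+1%:Z]intS mulrzDr mulr1z [L + _]addrC.
- apply: rst_trans IH _.
  have [_] := equivalent_subN G (D - L *~ (- k%:Z)) v.
  by rewrite -/L [k.+1%:Z]intS !mulrNz !opprK mulrzDr mulr1z -addrA [_ + L]addrC.
Qed.

Lemma ffun_mulz (n : nat) (D : divisor n) (a : int) (v : 'I_n) :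
  (D *~ a) v = D v * a.
Proof. by rewrite -mulrzz; case: a => k; rewrite /intmul ?ffunE ffunMnE. Qed.

Lemma equivalentE (n : nat) (G : graph n) (D D' : divisor n) :
  equivalent G D D' <-> exists s, D' = D - laplacian G s.
Proof.
split=> [|[s ->]].
  elim=> {D D'} [D _ [v ->]|D|D D' _ [s ->]|D D' D'' _ [s ->] _ [t ->]].
  - by exists (fun w => (w == v)%:R); rewrite fireE.
  - by exists (fun=> 0); rewrite laplacian0 subr0.
  - by exists (fun v => - s v); rewrite laplacianN opprK subrK.
  - by exists (fun v => s v + t v); rewrite laplacianD opprD addrA.
have -> : laplacian G s =
    \sum_v laplacian G (fun w => (w == v)%:R) *~ s v.
  apply/ffunP => w; rewrite sum_ffunE.
  under eq_bigr => v _.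
    rewrite ffun_mulz.
    rewrite ffunE mulrBl; over.
  rewrite ffunE sumrB; congr (_ - _).
    by rewrite (bigD1 w) //= eqxx mulr1 big1 ?addr0 // => i; rewrite eq_sym;
      move=> /negbTE ->; rewrite mulr0 mul0r.
  under [RHS]eq_bigr do rewrite big_distrl.
  rewrite exchange_big /=; apply: eq_bigr => u _.
  rewrite (bigD1 u) //= eqxx mul1r big1 ?addr0 // => i.
  by rewrite eq_sym => /negbTE ->; rewrite mul0r.
elim: (index_enum _) D => [|v r IH] D.
  by rewrite big_nil subr0; apply: rst_refl.
rewrite big_cons opprD addrA; apply: rst_trans (IH _).
exact: equivalent_fire_mul.
Qed.

Lemma deg_laplacian (n : nat) (G : graph n) (s : 'I_n -> int) :
  deg (laplacian G s) = 0.
Proof.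
rewrite /deg; under eq_bigr do rewrite ffunE.
rewrite sumrB (exchange_big_dep predT) //= -sumrB big1 // => v _.
rewrite (eq_bigl (adj G v)); last by move=> w; rewrite adj_sym.
by rewrite sumr_const /vdeg cardsE; apply/eqP; rewrite subr_eq0 mulrC -mulrzz.
Qed.

Lemma deg_equivalent (n : nat) (G : graph n) (D D' : divisor n) :
  equivalent G D D' -> deg D' = deg D.
Proof.
move=> /equivalentE[s ->]; rewrite -[RHS]subr0 -(deg_laplacian G s) /deg -sumrB.
by apply: eq_bigr => v _; rewrite !ffunE.
Qed.

Lemma deg_positive_rank_ge0 (n : nat) (G : graph n) (D : divisor n) :
  positive_rank G D -> 0 <= deg D.
Proof.
case: n G D => [|n] G D prD; first by rewrite /deg big_ord0.
have [E eqE effE] := prD ord0.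
have : 0 <= deg E by apply: sumr_ge0.
rewrite (deg_equivalent eqE) => /le_trans; apply; rewrite -subr_ge0 /deg -sumrB.
by apply: sumr_ge0 => v _; rewrite !ffunE opprB addrCA subrr addr0.
Qed.

Lemma positive_rank_ex (n : nat) (G : graph n) :
  exists d : nat, `[< exists2 D, positive_rank G D & deg D = d%:Z >].
Proof.
exists n; apply/asboolP; exists [ffun=> 1].
  move=> v; exists ([ffun=> 1] - vertex v); first exact: rst_refl.
  by move=> w; rewrite !ffunE; case: (w == v).
by rewrite /deg; under eq_bigr do rewrite ffunE; rewrite sumr_const card_ord natz.
Qed.

(** Ranging over natural degrees is harmless: see [gonality_min], where the
    degree is an arbitrary integer. *)
Definition gonality (n : nat) (G : graph n) : nat := ex_minn (positive_rank_ex G).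

Lemma gonality_attained (n : nat) (G : graph n) :
  exists2 D, positive_rank G D & deg D = (gonality G)%:Z.
Proof. by rewrite /gonality; case: ex_minnP => d /asboolP. Qed.

Lemma gonality_min (n : nat) (G : graph n) (D : divisor n) :
  positive_rank G D -> (gonality G)%:Z <= deg D.
Proof.
move=> prD; have := deg_positive_rank_ge0 prD.
case E : (deg D) => [d|//] _; rewrite /gonality lez_nat.
by case: ex_minnP => m _; apply; apply/asboolP; exists D.
Qed.

(** The law of G(n,p); it is a probability distribution when [0 <= p <= 1]. *)
Definition Gnp (R : realType) (n : nat) (p : R) (G : graph n) : R :=
  \prod_(e : vpair n) (if e \in G then p else 1 - p).

Definition Pr_Gnp (R : realType) (n : nat) (p : R) (A : pred (graph n)) : R :=
  \sum_(G | A G) Gnp p G.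

Lemma Gnp_ge0 (R : realType) (n : nat) (p : R) (G : graph n) :
  0 <= p <= 1 -> 0 <= Gnp p G.
Proof.
by move=> /andP[p0 p1]; apply: prodr_ge0 => e _; case: ifP; rewrite ?subr_ge0.
Qed.

Lemma Pr_GnpT (R : realType) (n : nat) (p : R) : Pr_Gnp p (@predT (graph n)) = 1.
Proof.
rewrite /Pr_Gnp /Gnp -bigA_distr big1 // => e _.
exact: subrKC.
Qed.

(** Independence, and marginal [p]: the edges in [S] are all present with
    probability [p ^+ #|S|]. *)
Lemma Pr_Gnp_sub (R : realType) (n : nat) (p : R) (S : {set vpair n}) :
  Pr_Gnp p (fun G : graph n => S \subset G) = p ^+ #|S|.
Proof.
rewrite /Pr_Gnp /Gnp.
transitivity (\sum_(G : {set vpair n})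
    \prod_e (if e \in G then p else if e \in S then 0 else 1 - p)).
  rewrite big_mkcond /=; apply: eq_bigr => G _; case: ifPn => [sub|].
    apply: eq_bigr => e _; case: ifPn => // eG; rewrite ifN //.
    by apply: contra eG => eS; apply: (fintype.subsetP sub).
  by case/subsetPn => e eS eG; rewrite (bigD1 e) //= (negbTE eG) eS mul0r.
rewrite -bigA_distr -prodr_const [RHS]big_mkcond /=.
by apply: eq_bigr => e _; case: ifP => _; [exact: addr0 | exact: subrKC].
Qed.

(* Main.v *)
Require Import Defs.
From mathcomp Require Import all_boot all_order all_algebra.
From mathcomp Require Import all_classical all_reals all_analysis.
From mathcomp Require Import ring lra zify.

(** Call a graph dense at scale [t] if any two disjoint vertex sets of size at
    least [t] are joined by at least [n] edges. In such a graph consider the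
    bramble of the connected sets of size at least [t], and let [D] be effective
    of positive rank and degree less than [n]. If a bramble element [B] misses
    the support of [D], reach a divisor with a chip on [B] by firing a chain of
    sets through effective divisors. Each cut crossed has at most [deg D < n]
    edges, so the fired set or its complement has size less than [t]. A large
    fired set would contain [B] and could not bring chips to it; a small one
    contains no bramble element, so no element already hit is lost. Hence some
    equivalent effective divisor hits strictly more of the bramble. When all of
    it is hit, the zero set of [D] contains no large connected set, so it has
    fewer than [3 t] vertices and [deg D >= n - 3 t].

    For G(n,c/n), a union bound over pairs of sets and an exponential Markov
    inequality bound the probability of not being dense at scale [t] by
    [8^n exp(- c t^2 / (2 n))], which vanishes for [t = n / c^(1/4)]. *)

Import Order.TTheory GRing.Theory Num.Theory.
Import numFieldNormedType.Exports.
Local Open Scope ring_scope.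
Set Implicit Arguments.
Unset Strict Implicit.
Unset Printing Implicit Defensive.

(** * Edge density, connected sets and the bramble *)

Section Graph.
Variables (n : nat) (G : graph n).
Implicit Types (A B U Z : {set 'I_n}) (D E : divisor n).

Definition edges_between A B : {set 'I_n * 'I_n} :=
  [set x | [&& x.1 \in A, x.2 \in B & adj G x.1 x.2]].

(** Connectedness of the induced subgraph, encoded by cuts because firing arguments need exactly a
    crossing edge. The empty set qualifies; the size bound with [0 < t] excludes it from the
    bramble. *)
Definition connected_set B : bool :=
  [forall U : {set 'I_n}, (B :&: U != finset.set0) ==> (B :\: U != finset.set0) ==>
    [exists x in B :&: U, exists y in B :\: U, adj G x y]].

Definition edge_dense (t : nat) : bool :=
  [forall A : {set 'I_n}, forall B : {set 'I_n},
    [&& [disjoint A & B], t <= #|A| & t <= #|B|]%N ==>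
    (n <= #|edges_between A B|)%N].

Definition hits D B : bool := [exists v in B, 0 < D v].

Definition unhit (t : nat) D : {set {set 'I_n}} :=
  [set B : {set 'I_n} | [&& connected_set B, (t <= #|B|)%N & ~~ hits D B]].

Lemma edge_denseP t A B : edge_dense t -> [disjoint A & B] -> (t <= #|A|)%N ->
  (t <= #|B|)%N -> (n <= #|edges_between A B|)%N.
Proof. by move=> /forallP /(_ A) /forallP /(_ B) /implyP H ? ? ?; apply/H/and3P. Qed.

Lemma edge_dense_adj t A B : edge_dense t -> (0 < n)%N -> [disjoint A & B] -> (t <= #|A|)%N ->
  (t <= #|B|)%N -> exists x y, [/\ x \in A, y \in B & adj G x y].
Proof.
move=> dt n0 dAB tA tB; have /(leq_trans n0) := edge_denseP dt dAB tA tB.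
by move=> /card_gt0P[[x y]]; rewrite inE => /and3P[xA yB xy]; exists x, y.
Qed.

Lemma connected_crossing B U : connected_set B -> B :&: U != finset.set0 ->
  B :\: U != finset.set0 ->
  exists x y, [/\ x \in B, x \in U, y \in B, y \notin U & adj G x y].
Proof.
move=> /forallP /(_ U) /implyP H /H /implyP{}H /H.
case/exists_inP => x /finset.setIP[xB xU] /exists_inP[y /finset.setDP[yB yU] xy].
by exists x, y.
Qed.

(* A minimal subset of size at least [t] with no edge to the rest of [Z] is
   connected: splitting it would give two such subsets of size less than [t],
   whereas density forces it to contain more than [#|Z| - t] vertices. *)
Lemma edge_dense_connected_subset t Z : edge_dense t -> (0 < n)%N -> (0 < t)%N ->
  (3 * t <= #|Z|)%N ->
  exists2 B : {set 'I_n}, B \subset Z & connected_set B && (t <= #|B|)%N.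
Proof.
move=> dt n0 t0 tZ.
pose P (X : {set 'I_n}) := [&& X \subset Z, (t <= #|X|)%N &
  [forall x in X, forall y in Z :\: X, ~~ adj G x y]].
have PZ : P Z.
  apply/and3P; split => //; first by lia.
  by apply/forall_inP => x _; apply/forall_inP => y; rewrite finset.setDv inE.
case: (arg_minnP (fun X : {set 'I_n} => #|X|) PZ) => X /and3P[XZ tX /forall_inP clX] minX.
have sep x y : x \in X -> y \in Z -> y \notin X -> ~~ adj G x y.
  by move=> xX yZ yX; have /forall_inP := clX x xX; apply; rewrite inE yX.
exists X => //; rewrite tX andbT.
have XZt : (#|Z :\: X| < t)%N.
  rewrite ltnNge; apply/negP => tD.
  have dXD : [disjoint X & Z :\: X].
    rewrite -finset.setI_eq0; apply/eqP/finset.setP => x.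
    by rewrite !inE; case: (x \in X).
  have [x [y [xX /finset.setDP[yZ yX] xy]]] := edge_dense_adj dt n0 dXD tX tD.
  by have := sep x y xX yZ yX; rewrite xy.
have cZ := cardsID X Z; rewrite (finset.setIidPr XZ) in cZ.
apply/forallP => U; apply/implyP => U0; apply/implyP => U1.
apply: contraT => noedge.
have noe x y : x \in X :&: U -> y \in X :\: U -> ~~ adj G x y.
  move=> xI yD; apply: contra noedge => xy.
  by apply/exists_inP; exists x => //; apply/exists_inP; exists y.
have cX := cardsID U X.
have small1 : (#|X :&: U| < t)%N.
  rewrite ltnNge; apply/negP => tI.
  have : P (X :&: U).
    apply/and3P; split => //.
      by apply: (fintype.subset_trans _ XZ); apply: finset.subsetIl.
    apply/forall_inP => x xI; apply/forall_inP => y /finset.setDP[yZ].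
    case: (boolP (y \in X)) => yX; last by move=> _; apply: sep => //; move/finset.setIP: xI => [].
    by rewrite inE yX /= => yU; apply: noe => //; rewrite inE yU.
  by move/minX; rewrite -card_gt0 in U1; lia.
have small2 : (#|X :\: U| < t)%N.
  rewrite ltnNge; apply/negP => tI.
  have : P (X :\: U).
    apply/and3P; split => //.
      by apply: (fintype.subset_trans _ XZ); apply: finset.subsetDl.
    apply/forall_inP => x xI; apply/forall_inP => y /finset.setDP[yZ].
    case: (boolP (y \in X)) => yX; last by move=> _; apply: sep => //; move/finset.setDP: xI => [].
    by rewrite inE yX andbT negbK => yU; rewrite adj_sym; apply: noe => //; rewrite inE yX.
  by move/minX; rewrite -card_gt0 in U0; lia.
by lia.
Qed.

(** * Firing a set of vertices and its effect on the bramble *)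

Lemma laplacianE (s : 'I_n -> int) w :
  laplacian G s w = \sum_(v | adj G w v) (s w - s v).
Proof.
rewrite ffunE sumrB sumr_const; congr (_ - _).
  by rewrite /vdeg cardsE mulrC -mulrzz -pmulrn.
by apply: eq_bigl => v; rewrite adj_sym.
Qed.

Definition charfun U : 'I_n -> int := fun v => (v \in U)%:R.

Lemma laplacian_charfun_in U w : w \in U ->
  laplacian G (charfun U) w = #|[set v | adj G w v && (v \notin U)]|%:R.
Proof.
move=> wU; rewrite laplacianE -sum1_card natr_sum /=.
under [RHS]eq_bigl do rewrite inE.
rewrite big_mkcondr /=; apply: eq_bigr => v _.
by rewrite /charfun wU; case: (v \in U); rewrite ?subrr ?subr0.
Qed.

Lemma laplacian_charfun_notin U w : w \notin U ->
  laplacian G (charfun U) w = - #|[set v | adj G w v && (v \in U)]|%:R.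
Proof.
move=> wU; rewrite laplacianE -sum1_card natr_sum /= -sumrN.
under [RHS]eq_bigl do rewrite inE.
rewrite big_mkcondr /=; apply: eq_bigr => v _.
by rewrite /charfun (negbTE wU) sub0r; case: (v \in U); rewrite ?oppr0.
Qed.

(** Discrete maximum principle: firing [s] brings no net chips to a vertex where [s] is maximal. *)
Lemma laplacian_max_ge0 (s : 'I_n -> int) v :
  (forall w, s w <= s v) -> 0 <= laplacian G s v.
Proof. by move=> sv; rewrite laplacianE sumr_ge0 // => w _; rewrite subr_ge0. Qed.

(** Inside the top level set [U], integrality makes [s] drop by at least 1 along each edge leaving
    [U], so firing [U] costs a vertex no more than firing all of [s]. Outside [U] vertices only
    gain. *)
Lemma effective_fire_max D (s : 'I_n -> int) U (m : int) :
  effective D -> effective (D - laplacian G s) ->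
  (forall v, v \in U -> s v = m) -> (forall v, v \notin U -> s v < m) ->
  effective (D - laplacian G (charfun U)).
Proof.
move=> effD effDs sU sNU v; case: (boolP (v \in U)) => vU.
  apply: le_trans (effDs v) _; rewrite [leLHS]ffunE [leRHS]ffunE lerD2l.
  rewrite [leLHS]ffunE [leRHS]ffunE lerN2 !laplacianE; apply: ler_sum => w _.
  rewrite /charfun vU sU //; case: (boolP (w \in U)) => wU; first by rewrite sU // !subrr.
  by rewrite subr0; have := sNU _ wU; lia.
rewrite ffunE [X in _ + X]ffunE laplacian_charfun_notin // opprK.
by apply: addr_ge0 => //; apply: effD.
Qed.

(** Each vertex of [U] pays one chip per cut edge at it, and must already own these chips. *)
Lemma fire_cut_le_deg D U : effective D -> effective (D - laplacian G (charfun U)) ->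
  (#|edges_between U (~: U)|%:Z <= deg D)%R.
Proof.
move=> effD effDU.
have -> : #|edges_between U (~: U)| =
    (\sum_(x in U) #|[set y | adj G x y && (y \notin U)]|)%N.
  rewrite -sum1_card; under [RHS]eq_bigr do rewrite -sum1_card.
  rewrite pair_big_dep /=; apply: eq_bigl => -[x y]; rewrite !inE /=.
  by congr (_ && _); rewrite andbC.
rewrite -natz natr_sum /deg [leRHS](bigID (mem U)) /= -[leLHS]addr0 lerD //; last first.
  by apply: sumr_ge0.
apply: ler_sum => x xU; have := effDU x.
by rewrite ffunE [X in _ + X]ffunE laplacian_charfun_in // subr_ge0.
Qed.

(** An edge of [B] leaving [U] would cost its endpoint in [U] a chip, and [B] has none. *)
Lemma unhit_fire_uncrossed D U B : effective D ->
  effective (D - laplacian G (charfun U)) -> connected_set B -> ~~ hits D B ->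
  B :&: U != finset.set0 -> B \subset U.
Proof.
move=> effD effDU cB uB BU; rewrite -finset.setD_eq0; apply: contraT => BDU.
have [x [y [xB xU yB yU xy]]] := connected_crossing cB BU BDU.
case/negP: uB; apply/existsP; exists x; rewrite xB /=.
have := effDU x; rewrite ffunE [X in _ + X]ffunE laplacian_charfun_in // subr_ge0.
by apply: lt_le_trans; rewrite ltr0n card_gt0; apply/finset.set0Pn; exists y; rewrite inE xy.
Qed.

(** [B] is too large to fit in [U]. If it misses [U] it keeps its chips; otherwise a crossing edge
    delivers a chip to its endpoint in [B] outside [U]. *)
Lemma hits_fire_small t D U B : effective D ->
  effective (D - laplacian G (charfun U)) -> connected_set B ->
  (t <= #|B|)%N -> (#|U| < t)%N -> hits D B -> hits (D - laplacian G (charfun U)) B.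
Proof.
move=> effD effDU cB tB Ut hB.
have BDU : B :\: U != finset.set0.
  rewrite finset.setD_eq0; apply/negP => /subset_leq_card; lia.
have [/eqP BU|BU] := boolP (B :&: U == finset.set0).
  case/existsP: hB => v /andP[vB Dv]; apply/existsP; exists v; rewrite vB /=.
  have vU : v \notin U by apply/negP => vU; have := finset.in_set0 v; rewrite -BU inE vB vU.
  by rewrite ffunE [X in _ + X]ffunE laplacian_charfun_notin // opprK ltr_pwDl.
have [x [y [xB xU yB yU xy]]] := connected_crossing cB BU BDU.
apply/existsP; exists y; rewrite yB /= ffunE [X in _ + X]ffunE.
rewrite laplacian_charfun_notin // opprK ltr_wpDl // ltr0n card_gt0.
by apply/finset.set0Pn; exists x; rewrite inE adj_sym xy.
Qed.

(** Induction on the bound [M]: the top level set of [s] is fired first, which keeps the divisor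
    effective, until [B] receives a chip. *)
Lemma unhit_decrease t D (s : 'I_n -> nat) M B v :
  edge_dense t -> effective D -> deg D < n%:Z ->
  effective (D - laplacian G (fun w => (s w)%:Z)) ->
  (forall w, s w <= M)%N ->
  B \in unhit t D -> v \in B -> 0 < (D - laplacian G (fun w => (s w)%:Z)) v ->
  exists D', [/\ equivalent G D D', effective D' & unhit t D' \proper unhit t D].
Proof.
move=> dt; elim: M D s => [|M IH] D s effD degD effDs sM uB vB Dsv.
  have D0 : D - laplacian G (fun w => (s w)%:Z) = D.
    rewrite (@eq_laplacian _ _ _ (fun=> 0)) ?laplacian0 ?subr0 // => w.
    by apply/eqP; have := sM w; rewrite leqn0.
  move: uB; rewrite inE => /and3P[_ _ /negP[]].
  by apply/existsP; exists v; rewrite vB -D0.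
pose U := [set w | s w == M.+1].
have sU w : w \in U -> (s w)%:Z = M.+1%:Z by rewrite inE => /eqP ->.
have sNU w : w \notin U -> (s w)%:Z < M.+1%:Z.
  by rewrite inE => swM; have := sM w; rewrite ltz_nat; lia.
have effDU := effective_fire_max effD effDs sU sNU.
have eqDU : equivalent G D (D - laplacian G (charfun U)) by apply/equivalentE; exists (charfun U).
have := uB; rewrite inE => /and3P[cB tB hB].
have Dv : D v = 0.
  apply/eqP; rewrite eq_le effD andbT leNgt; apply/negP => Dv.
  by case/negP: hB; apply/existsP; exists v; rewrite vB.
(* Large [U]: its cut has fewer than [n] edges, so density makes [~: U] too small to contain [B].
   Hence [B] lies in [U], and [v], at the maximum of [s], cannot gain the chip that [D] lacks
   there. *)
have [Ut|tU] := ltnP #|U| t; last first.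
  have Uct : (#|~: U| < t)%N.
    rewrite ltnNge; apply/negP => tUc.
    have dU : [disjoint U & ~: U] by rewrite -finset.setI_eq0 finset.setICr.
    have := le_lt_trans (fire_cut_le_deg effD effDU) degD.
    by rewrite ltz_nat ltnNge (edge_denseP dt dU tU tUc).
  have BU : B :&: U != finset.set0.
    rewrite finset.setI_eq0 finset.disjoints_subset.
    by apply/negP => /subset_leq_card /(leq_trans tB); rewrite leqNgt Uct.
  have vU := fintype.subsetP (unhit_fire_uncrossed effD effDU cB hB BU) v vB.
  move: Dsv; rewrite ffunE [X in _ + X]ffunE Dv sub0r oppr_gt0 ltNge.
  rewrite laplacian_max_ge0 // => w; rewrite (sU v vU) lez_nat; exact: sM.
have sub : unhit t (D - laplacian G (charfun U)) \subset unhit t D.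
  apply/fintype.subsetP => C; rewrite !inE => /and3P[cC tC uC].
  by rewrite cC tC; apply: contra uC => hC; apply: (hits_fire_small effD effDU cC tC Ut hC).
have [hB'|uB'] := boolP (hits (D - laplacian G (charfun U)) B).
  exists (D - laplacian G (charfun U)); split => //.
  by apply/fintype.properP; split => //; exists B => //; rewrite inE cB tB hB'.
have degDU : deg (D - laplacian G (charfun U)) < n%:Z by rewrite (deg_equivalent eqDU).
(* [B] is still unhit. The rest of the script is [s] with its top level lowered by one; it leads to
   the same final divisor. *)
pose s' w := (s w - (w \in U))%N.
have E : D - laplacian G (charfun U) - laplacian G (fun w => (s' w)%:Z) =
    D - laplacian G (fun w => (s w)%:Z).
  rewrite -addrA -opprD -laplacianD; congr (_ - _); apply: eq_laplacian => w.
  rewrite /charfun /s'; case: (boolP (w \in U)) => [|_]; last by rewrite subn0 add0r.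
  by rewrite inE => /eqP ->; rewrite subn1 /= -PoszD.
have s'M w : (s' w <= M)%N.
  rewrite /s' leq_subLR; case: (boolP (w \in U)) => [_|/sNU].
    by rewrite add1n.
  by rewrite ltz_nat ltnS.
have uB1 : B \in unhit t (D - laplacian G (charfun U)) by rewrite inE cB tB uB'.
rewrite -E in effDs Dsv.
have [D' [eqD' effD' pD']] := IH _ s' effDU degDU effDs s'M uB1 vB Dsv.
exists D'; split => //; last exact: fintype.proper_sub_trans pD' sub.
by apply: Relation_Operators.rst_trans eqD'.
Qed.

(** * Positive rank and the lower bound on gonality *)

Lemma effective_vertexD D v : effective D -> effective (D + vertex v).
Proof. by move=> effD w; rewrite !ffunE addr_ge0. Qed.

(** Constants lie in the kernel of the Laplacian, so a script can be shifted to be nonnegative. *)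
Lemma equivalent_nat_firing D E : equivalent G D E ->
  exists s : 'I_n -> nat, E = D - laplacian G (fun w => (s w)%:Z).
Proof.
move=> /equivalentE[s ->]; pose m := \sum_v `|s v|.
have sm w : 0 <= s w + m.
  rewrite -lerBlDl sub0r; apply: le_trans (ler_norm _) _.
  by rewrite normrN /m (bigD1 w) //= lerDl sumr_ge0.
exists (fun w => absz (s w + m)); congr (_ - _); apply/ffunP => w.
by rewrite !laplacianE; apply: eq_bigr => v _; rewrite !gez0_abs // opprD addrACA subrr addr0.
Qed.

Lemma positive_rank_equivalent D E :
  equivalent G D E -> positive_rank G D -> positive_rank G E.
Proof.
move=> eqDE prD v; have [F eqF effF] := prD v; exists F => //.
apply: Relation_Operators.rst_trans eqF.
have /equivalentE[s ->] := eqDE; apply: Relation_Operators.rst_sym.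
by apply/equivalentE; exists s; rewrite addrAC.
Qed.

Lemma effective_reach D v : positive_rank G D ->
  exists E, [/\ equivalent G D E, effective E & 0 < E v].
Proof.
move=> prD; have [F eqF effF] := prD v; exists (F + vertex v); split.
- have /equivalentE[s ->] := eqF; apply/equivalentE; exists s.
  by rewrite addrAC subrK.
- exact: effective_vertexD.
- by rewrite !ffunE eqxx ltr_wpDl.
Qed.

Lemma edge_dense_deg_effective t D : edge_dense t -> (0 < n)%N -> (0 < t)%N ->
  effective D -> positive_rank G D -> n%:Z - (3 * t)%:Z <= deg D.
Proof.
move=> dt n0 t0; have [k] := ubnP #|unhit t D|.
elim: k D => // k IH D uk effD prD.
(* Degree at least [n] gives the bound at once; below [n], [unhit_decrease] applies. *)
have [nD|degD] := lerP n%:Z (deg D).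
  by apply: le_trans nD; rewrite lerBlDr lerDl.
have [uD|/finset.set0Pn[B uB]] := boolP (unhit t D == finset.set0); last first.
  have := uB; rewrite inE => /and3P[cB tB hB].
  have /card_gt0P[v vB] : (0 < #|B|)%N by apply: leq_trans tB.
  have [E [eqE effE Ev]] := effective_reach v prD.
  have [s Es] := equivalent_nat_firing eqE; rewrite Es in effE Ev.
  have sM w : (s w <= \sum_u s u)%N by rewrite (bigD1 w) //= leq_addr.
  have [D' [eqD' effD' /proper_card ltD']] :=
    unhit_decrease dt effD degD effE sM uB vB Ev.
  rewrite -(deg_equivalent eqD'); apply: IH => //; first exact: leq_trans ltD' uk.
  exact: positive_rank_equivalent prD.
pose Z := [set v | D v == 0].
have Zt : (#|Z| < 3 * t)%N.
  rewrite ltnNge; apply/negP => /(edge_dense_connected_subset dt n0 t0)[B BZ /andP[cB tB]].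
  move/eqP/finset.setP/(_ B): uD; rewrite !inE cB tB /= => /negbFE/exists_inP[v vB].
  by have := fintype.subsetP BZ v vB; rewrite inE => /eqP ->.
have cZ : n = (#|Z| + #|~: Z|)%N by rewrite cardsC card_ord.
rewrite lerBlDr; apply: le_trans (_ : (#|~: Z| + 3 * t)%:Z <= _).
  by rewrite lez_nat [leqLHS]cZ addnC leq_add2l ltnW.
rewrite PoszD lerD2r -sum1_card -natz natr_sum big_mkcond /=.
apply: ler_sum => v _; rewrite !inE; case: eqP => [->//|/eqP Dv] /=.
by rewrite -gtz0_ge1 lt_def Dv effD.
Qed.

Lemma edge_dense_gonality t : edge_dense t -> (0 < t)%N -> (n <= gonality G + 3 * t)%N.
Proof.
move=> dt t0; have [n_le0|n0] := leqP n 0; first exact: leq_trans n_le0 _.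
have [D prD degD] := gonality_attained G.
have [E [eqE effE _]] := effective_reach (Ordinal n0) prD.
have := edge_dense_deg_effective dt n0 t0 effE (positive_rank_equivalent eqE prD).
by rewrite (deg_equivalent eqE) degD lerBlDr -PoszD lez_nat.
Qed.

End Graph.

(** * Potential edges between two vertex sets, independently of the graph *)

Definition cross_pairs n (A B : {set 'I_n}) : {set vpair n} :=
  [set e | [exists a in A, exists b in B, val e == [set a; b]]].

(** Disjointness makes [(a, b) |-> [set a; b]] injective on the product and its values genuine
    pairs. *)
Lemma leq_card_cross_pairs n (A B : {set 'I_n}) :
  [disjoint A & B] -> (#|A| * #|B| <= #|cross_pairs A B|)%N.
Proof.
move=> dAB; rewrite -cardsX.
pose h (x : 'I_n * 'I_n) := [set x.1; x.2].
have injh : {in finset.setX A B &, injective h}.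
  move=> [a b] [a' b']; rewrite !inE /h /= => /andP[aA bB] /andP[a'A b'B] E.
  have nAB x : x \in A -> x \in B -> False.
    by move=> xA xB; rewrite (disjointFr dAB xA) in xB.
  have : a \in [set a'; b'] by rewrite -E !inE eqxx.
  have : b \in [set a'; b'] by rewrite -E !inE eqxx orbT.
  rewrite !inE => /orP[/eqP bE|/eqP <-]; first by case: (nAB b); rewrite // bE.
  by move=> /orP[/eqP <-//|/eqP aE]; case: (nAB a); rewrite // aE.
rewrite -(card_in_imset injh) -(card_imset (mem (cross_pairs A B)) val_inj).
apply: subset_leq_card; apply/fintype.subsetP => _ /imsetP[[a b] /finset.setXP[aA bB] ->].
have ab : #|[set a; b]| == 2%N.
  rewrite cards2; case: (eqVneq a b) => // E; move: bB.
  by rewrite -E (disjointFr dAB aA).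
apply/imsetP; exists (Sub [set a; b] ab : vpair n) => //.
rewrite inE; apply/exists_inP; exists a => //; apply/exists_inP; exists b => //.
Qed.

Lemma card_cross_pairs_edges n (G : graph n) (A B : {set 'I_n}) :
  (#|G :&: cross_pairs A B| <= #|edges_between G A B|)%N.
Proof.
rewrite -(card_imset (mem (G :&: cross_pairs A B)) val_inj).
pose h (x : 'I_n * 'I_n) := [set x.1; x.2].
apply: leq_trans (leq_imset_card h (mem (edges_between G A B))).
apply: subset_leq_card; apply/fintype.subsetP => _ /imsetP[e /finset.setIP[eG +] ->].
rewrite inE => /exists_inP[a aA /exists_inP[b bB /eqP eab]].
apply/imsetP; exists (a, b) => //; rewrite inE aA bB /=.
by apply/imsetP; exists e.
Qed.

(** * Tail estimate and union bound in G(n,p) *)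

Section Probability.
Variables (R : realType) (n : nat) (p : R).
Hypothesis p01 : 0 <= p <= 1.

Lemma Pr_Gnp_le (P Q : pred (graph n)) :
  (forall G, P G -> Q G) -> Pr_Gnp p P <= Pr_Gnp p Q.
Proof.
move=> PQ; rewrite /Pr_Gnp [leLHS]big_mkcond [leRHS]big_mkcond /=.
apply: ler_sum => G _; case: ifP => [/PQ ->//|_].
by case: ifP => // _; apply: Gnp_ge0.
Qed.

Lemma Pr_GnpC (P : pred (graph n)) :
  Pr_Gnp p P = 1 - Pr_Gnp p (fun G => ~~ P G).
Proof. by rewrite -(Pr_GnpT n p) {2}/Pr_Gnp (bigID P) /= addrK. Qed.

(** Generating function of a binomial variable: independence factors the sum edge by edge. *)
Lemma Gnp_generating (S : {set vpair n}) (z : R) :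
  \sum_(G : graph n) Gnp p G * z ^+ #|G :&: S| = (1 - p + p * z) ^+ #|S|.
Proof.
transitivity (\sum_(G : graph n)
    \prod_e (if e \in G then p * (if e \in S then z else 1) else 1 - p)).
  apply: eq_bigr => G _; rewrite -prodr_const [X in _ * X]big_mkcond /=.
  rewrite -big_split /=; apply: eq_bigr => e _; rewrite inE.
  by case: (e \in G); rewrite ?mulr1.
rewrite -bigA_distr -prodr_const [RHS]big_mkcond /=.
apply: eq_bigr => e _; case: ifP => _; first by rewrite addrC.
by rewrite mulr1 subrKC.
Qed.

(* Markov's inequality for [2 ^- #|G :&: S|]. *)
Lemma Pr_Gnp_few (S : {set vpair n}) (k : nat) :
  Pr_Gnp p (fun G => #|G :&: S| < k)%N <= 2 ^+ k * (1 - p / 2) ^+ #|S|.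
Proof.
have -> : 1 - p / 2 = 1 - p + p * 2^-1 by lra.
rewrite -Gnp_generating mulr_sumr /Pr_Gnp big_mkcond /=.
have G0 G : 0 <= Gnp p G by apply: Gnp_ge0.
apply: ler_sum => G _; case: ifP => [lk|_]; last first.
  by rewrite mulr_ge0 ?exprn_ge0 ?mulr_ge0 // exprn_ge0 // invr_ge0.
rewrite mulrCA ler_peMr // exprVn -ler_pdivrMr ?invr_gt0 ?exprn_gt0 //.
by rewrite invrK mul1r ler_eXn2l ?ltr1n // ltnW.
Qed.

(** The factor [8 ^+ n] combines [4 ^+ n] pairs of vertex sets with the [2 ^+ n] of the Markov
    bound. *)
Lemma Pr_Gnp_not_edge_dense (t : nat) :
  Pr_Gnp p (fun G : graph n => ~~ edge_dense G t) <=
  8 ^+ n * (1 - p / 2) ^+ (t * t).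
Proof.
have G0 G : 0 <= Gnp p G by apply: Gnp_ge0.
have /andP[p0 p1] := p01.
have q0 : 0 <= 1 - p / 2 by lra.
have q1 : 1 - p / 2 <= 1 by lra.
pose C (X : {set 'I_n} * {set 'I_n}) :=
  [&& [disjoint X.1 & X.2], t <= #|X.1| & t <= #|X.2|]%N.
pose few G (X : {set 'I_n} * {set 'I_n}) := (#|G :&: cross_pairs X.1 X.2| < n)%N.
apply: (@le_trans _ _ (\sum_(X | C X) Pr_Gnp p (fun G => few G X))).
  rewrite /Pr_Gnp (exchange_big_dep predT) //= [leLHS]big_mkcond /=.
  apply: ler_sum => G _; case: ifPn => [|_]; last by apply: sumr_ge0.
  case/forallPn => A /forallPn[B]; rewrite negb_imply => /andP[cAB].
  rewrite -ltnNge => eAB.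
  rewrite (bigD1 (A, B)) /=; last first.
    by rewrite /C cAB /few /=; apply: leq_ltn_trans (card_cross_pairs_edges _ _ _) eAB.
  by rewrite lerDl sumr_ge0.
apply: (@le_trans _ _ (\sum_(X : {set 'I_n} * {set 'I_n})
    2 ^+ n * (1 - p / 2) ^+ (t * t))).
  rewrite big_mkcond /=; apply: ler_sum => X _; case: ifP => [/and3P[dX tA tB]|_].
    apply: le_trans (Pr_Gnp_few _ _) _; rewrite ler_wpM2l ?exprn_ge0 //.
    apply: ler_wiXn2l => //; apply: leq_trans (leq_card_cross_pairs dX).
    exact: leq_mul.
  by rewrite mulr_ge0 // exprn_ge0.
have cardI : #|{: {set 'I_n}}| = (2 ^ n)%N.
  by rewrite -cardsT -powersetT card_powerset cardsT card_ord.
rewrite sumr_const card_prod cardI -expnMn -[leLHS]mulr_natr mulrAC.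
by rewrite natrX -exprMn -natrM.
Qed.

Lemma Pr_Gnp_gonality (t : nat) : (0 < t)%N ->
  1 - 8 ^+ n * (1 - p / 2) ^+ (t * t) <=
  Pr_Gnp p (fun G : graph n => n%:R - (3 * t)%:R <= (gonality G)%:R :> R).
Proof.
move=> t0; apply: le_trans (_ : Pr_Gnp p (fun G => edge_dense G t) <= _).
  by rewrite [leRHS]Pr_GnpC lerB // Pr_Gnp_not_edge_dense.
apply: Pr_Gnp_le => G dG.
by rewrite lerBlDr -natrD ler_nat; apply: edge_dense_gonality.
Qed.

End Probability.

(** * Choice of the scale and passage to the limit *)

Lemma not_edge_dense_bound (R : realType) (n t : nat) (s : R) :
  4 <= s -> s ^+ 4 <= n%:R -> n%:R / s <= t%:R ->
  8 ^+ n * (1 - s ^+ 4 / n%:R / 2) ^+ (t * t) <= n.+1%:R^-1.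
Proof.
move=> s4 sn nt; have s0 : 0 < s by lra.
have n0 : 0 < n%:R :> R by apply: lt_le_trans sn; rewrite exprn_gt0.
set p := s ^+ 4 / n%:R.
have p1 : p <= 1 by rewrite ler_pdivrMr // mul1r.
have le1 : (1 - p / 2) ^+ (t * t) <= expR ((t * t)%:R * - (p / 2)).
  rewrite expRM_natl lerXn2r ?nnegrE ?expR_ge0 //; first by lra.
  exact: expR_ge1Dx.
(* Budget of exponents: 8 is at most [expR 7], while [4 <= s] gives [s ^+ 2 / 2 >= 8]. The product
   is at most [expR (- n%:R)]. *)
have le2 : 8 ^+ n <= expR (n%:R * 7) :> R.
  rewrite expRM_natl lerXn2r ?nnegrE ?expR_ge0 //.
  by apply: le_trans (expR_ge1Dx _); lra.
have tp : n%:R * 8 <= (t * t)%:R * (p / 2).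
  apply: le_trans (_ : (n%:R / s) ^+ 2 * (p / 2) <= _).
    have -> : (n%:R / s) ^+ 2 * (p / 2) = n%:R * (s ^+ 2 / 2).
      by rewrite /p; field; rewrite !gt_eqF.
    by rewrite ler_wpM2l ?(ltW n0) //; nra.
  rewrite natrM -expr2 ler_wpM2r //.
    by rewrite !divr_ge0 // exprn_ge0 // ltW.
  by rewrite lerXn2r ?nnegrE // divr_ge0 // ltW.
have q0 : 0 <= (1 - p / 2) ^+ (t * t) by rewrite exprn_ge0 //; lra.
apply: le_trans (ler_pM _ q0 le2 le1) _; first by rewrite exprn_ge0.
rewrite -expRD; apply: le_trans (_ : expR (- n%:R) <= _).
  by rewrite ler_expR mulrN; lra.
rewrite expRN lef_pV2 ?posrE ?expR_gt0 //.
by rewrite -natr1 addrC expR_ge1Dx.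
Qed.

Local Open Scope classical_set_scope.

Theorem theorem2p5 (R : realType) (c : nat -> R)
    (c_gt0 : forall n : nat, 0 < c n)
    (c_unbounded : c n @[n --> \oo] --> +oo)
    (c_littleo : c =o_\oo (fun n : nat => n%:R : R)) :
  exists f : nat -> R,
    f =o_\oo (fun n : nat => n%:R : R) /\
    Pr_Gnp (c n / n%:R)
      (fun G : graph n => n%:R - f n <= (gonality G)%:R) @[n --> \oo] --> (1 : R).
Proof.
pose s n := Num.sqrt (Num.sqrt (c n)).
have s4 n : s n ^+ 4 = c n.
  by rewrite (exprM _ 2 2) !sqr_sqrtr ?sqrtr_ge0 // ltW.
have s_gt0 n : 0 < s n by rewrite !sqrtr_gt0.
have s_ge M : \forall n \near \oo, M <= s n.
  near=> n; apply: le_trans (ler_norm _) _.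
  rewrite -(@ler_pXn2r _ 4) ?nnegrE ?normr_ge0 ?(ltW (s_gt0 _)) // s4.
  by near: n; apply: cvgry_ge.
(* The successor makes [t n] positive and at least [n%:R / s n]. *)
pose t n := (Num.truncn (n%:R / s n)).+1.
have t_itv n : n%:R / s n <= (t n)%:R <= n%:R / s n + 1.
  have /truncn_itv/andP[t1 t2] : 0 <= n%:R / s n by rewrite divr_ge0 // ltW.
  by rewrite (ltW t2) /t -natr1 lerD2r t1.
exists (fun n => (3 * t n)%:R); split.
  (* As [3 * t n] is at most [3 * (n / s n) + 3], the threshold [6 / e] on both [n] and [s n] bounds
     each summand by [e * n / 2]. *)
  apply/eqoP => e e0; near=> n.
  have en : 6 / e <= n%:R by near: n; apply: nbhs_infty_ger.
  have es : 6 / e <= s n by near: n; apply: s_ge.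
  rewrite !ger0_norm // natrM.
  have /andP[_ tn] := t_itv n.
  have h1 : 6 <= e * n%:R by rewrite mulrC -ler_pdivrMr.
  have h2 : 6 * (n%:R / s n) <= e * n%:R.
    rewrite mulrA ler_pdivrMr // mulrAC ler_wpM2r //.
    by rewrite mulrC -ler_pdivrMr.
  lra.
(* [c n / n] is only eventually a probability: this is [c = o(n)] with constant 1. *)
have p01 : \forall n \near \oo, 0 <= c n / n%:R <= 1.
  have /eqoP/(_ 1 ltr01) := c_littleo.
  apply: filter_app; near=> n => /=; rewrite mul1r !ger0_norm ?(ltW (c_gt0 n)) // => cn.
  have n0 : 0 < n%:R :> R by apply: lt_le_trans cn.
  by rewrite divr_ge0 ?(ltW (c_gt0 n)) //= ler_pdivrMr ?mul1r.
apply: (@squeeze_cvgr _ _ _ _ (fun n => 1 - n.+1%:R^-1) (fun=> 1)).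
- near=> n.
  have pn : 0 <= c n / n%:R <= 1 by near: n.
  have sn : 4 <= s n by near: n; apply: s_ge.
  apply/andP; split.
    apply: le_trans (Pr_Gnp_gonality n pn (ltn0Sn _)); rewrite lerB //.
    rewrite -s4; apply: not_edge_dense_bound => //.
      have n0 : 0 < n%:R :> R by near: n; apply: nbhs_infty_gtr.
      by rewrite s4; case/andP: pn => _; rewrite ler_pdivrMr // mul1r.
    by case/andP: (t_itv n).
  by rewrite -[leRHS](Pr_GnpT n (c n / n%:R)); apply: (Pr_Gnp_le pn).
- rewrite -[X in _ --> X]subr0; apply: cvgB; first exact: cvg_cst.
  exact: cvg_harmonic.
- exact: cvg_cst.
Unshelve. all: by end_near.
Qed.
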